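(* For type $B$, let $\mathcal B_r=\{\sigma\in W_r:\wp(\sigma(\tilde\alpha+\rho)-\rho)>0\}$ be the Weyl alternation set of the Lie algebra of type $B_r$ ($r\ge 2$); let $P_0=P_1=\emptyset$ and, for $r\ge 2$, let $P_r$ be the set of all elements of $\mathcal B_r$ which do not contain a factor of $s_r$. Then for every $r\ge 2$, \[|\mathcal B_r|=|P_r|+|P_{r-1}|+|P_{r-2}|.\]
   Context: Type $B_r$ ($\mathfrak{so}_{2r+1}(\mathbb C)$, $r\ge 2$): simple roots $\alpha_i=\varepsilon_i-\varepsilon_{i+1}$ for $1\le i\le r-1$ and $\alpha_r=\varepsilon_r$; positive roots $\Phi^+=\{\varepsilon_i-\varepsilon_j,\varepsilon_i+\varepsilon_j:1\le i<j\le r\}\cup\{\varepsilon_i:1\le i\le r\}$; highest root $\tilde\alpha=\alpha_1+2\alpha_2+\cdots+2\alpha_r$; $\rho=\frac12\sum_{\alpha\in\Phi^+}\alpha$. $s_i$ denotes the simple reflection in $\alpha_i$, and $W_r$ is the Weyl group generated by $s_1,\dots,s_r$. $\wp(\xi)$ is Kostant's partition function: the number of ways $\xi$ may be written as a nonnegative integral sum of positive roots. An element of $W_r$ contains a factor of $s_r$ if $s_r$ occurs in a (equivalently, every) reduced expression for it. *)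

(* Defs.v *)
From HB Require Import structures.
From mathcomp Require Import all_boot all_order all_algebra finmap.
From mathcomp Require Import all_classical.

Set Implicit Arguments.
Unset Strict Implicit.
Unset Printing Implicit Defensive.

Import Order.TTheory GRing.Theory Num.Theory.
Local Open Scope classical_set_scope.
Local Open Scope ring_scope.

(* Type B_r in the coordinates of QQ^r (column vectors, so that a matrix acts
   on the left and a product of matrices is the composite of the maps).
   Indices start from 0: what is usually written e_k, alpha_k, s_k is
   [eps r k.-1], [simple_root i], [simple_refl i] with i of value k.-1. *)

Definition eps (r k : nat) : 'cV[rat]_r := \col_(j < r) ((j : nat) == k)%:R.

Definition simple_root (r : nat) (i : 'I_r) : 'cV[rat]_r :=
  if (i.+1 < r)%N then eps r i - eps r i.+1 else eps r i.

Definition pos_root_seq (r : nat) : seq 'cV[rat]_r :=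
  let pairs := [seq p : 'I_r * 'I_r <- enum {: 'I_r * 'I_r} | (p.1 < p.2)%N] in
  [seq eps r p.1 - eps r p.2 | p : 'I_r * 'I_r <- pairs] ++
  [seq eps r p.1 + eps r p.2 | p : 'I_r * 'I_r <- pairs] ++
  [seq eps r i | i : 'I_r <- enum 'I_r].

Definition pos_roots (r : nat) : {fset 'cV[rat]_r} :=
  [fset a in pos_root_seq r]%fset.

Definition highest_root (r : nat) : 'cV[rat]_r :=
  \sum_(i < r) simple_root i *+ (if (i : nat) == 0%N then 1 else 2).

Definition rho (r : nat) : 'cV[rat]_r := 2^-1 *: \sum_(a <- pos_roots r) a.

Definition dot (r : nat) (u v : 'cV[rat]_r) : rat := \sum_(j < r) u j 0 * v j 0.

(* The matrix of v |-> v - 2 (v, a) / (a, a) a. *)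
Definition reflection (r : nat) (a : 'cV[rat]_r) : 'M[rat]_r :=
  1%:M - (2 / dot a a) *: (a *m a^T).

Definition simple_refl (r : nat) (i : 'I_r) : 'M[rat]_r :=
  reflection (simple_root i).

Definition word_prod (r : nat) (w : seq 'I_r) : 'M[rat]_r :=
  \prod_(i <- w) simple_refl i.

(* The generators are involutions, so the group they generate consists of
   their finite products. *)
Definition weyl_group (r : nat) : set 'M[rat]_r := range (@word_prod r).
Arguments weyl_group : clear implicits.

Definition reduced_expression (r : nat) (sigma : 'M[rat]_r) (w : seq 'I_r) :
    Prop :=
  word_prod w = sigma /\
  forall w' : seq 'I_r, word_prod w' = sigma -> (size w <= size w')%N.

Definition contains_factor (r : nat) (i : 'I_r) (sigma : 'M[rat]_r) : Prop :=
  exists2 w : seq 'I_r, reduced_expression sigma w & i \in w.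

(* [fset_set] sends an infinite set to the empty one; every set whose
   cardinality is taken here is finite. *)
Definition set_card (T : choiceType) (A : set T) : nat := #|` fset_set A|.

Definition kostant (r : nat) (xi : 'cV[rat]_r) : nat :=
  set_card [set m : {ffun pos_roots r -> nat} |
             \sum_(a : pos_roots r) fsval a *+ m a = xi].

Definition alternation_set (r : nat) : set 'M[rat]_r :=
  [set sigma | weyl_group r sigma /\
     (0 < kostant (sigma *m (highest_root r + rho r) - rho r))%N].
Arguments alternation_set : clear implicits.

Definition P_set (r : nat) : set 'M[rat]_r :=
  if (r < 2)%N then set0
  else [set sigma | alternation_set r sigma /\
          forall i : 'I_r, i.+1 = r -> ~ contains_factor i sigma].
Arguments P_set : clear implicits.

(* Main.v *)
Require Import Defs.
From mathcomp Require Import all_boot all_order all_algebra all_fingroup finmap.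
From mathcomp Require Import all_classical.
From mathcomp Require Import zify ring lra.

Set Implicit Arguments.
Unset Strict Implicit.
Unset Printing Implicit Defensive.

Import Order.TTheory GRing.Theory Num.Theory.
Local Open Scope classical_set_scope.
Local Open Scope ring_scope.

(** Write L = highest root + rho = (r + 1/2, r - 1/2, r - 5/2, r - 7/2, ..., 1/2).
    The entries of L are positive and distinct, so sigma |-> sigma L is injective
    on the Weyl group, which consists of the signed permutations of the
    coordinates ([weyl_groupP]); a class is thus counted by counting vectors.

    A vector is a nonnegative integral sum of positive roots exactly when its
    partial sums, which are its coordinates on the simple roots, are natural
    numbers ([kostant_gt0]).  Hence the Weyl alternation set corresponds to the
    signed rearrangements t of L each of whose prefixes has at least the sum of
    the prefix of rho of the same length ([image_alternation_set]).  An element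
    avoids s_r exactly when it changes no sign: forgetting signs turns s_r into
    the identity, so in a word for an unsigned permutation every s_r can be
    erased ([no_last_factorP]).  So P_r corresponds to the positive t
    ([image_P_set]).

    It remains to count the t with a negative entry.  The sum of L exceeds that
    of rho by 2 only, and negating an entry y costs 2 y, so the negative entry
    can only be - 1/2, and then the total excess over rho is 1.  An entry
    following - 1/2 is at least 3/2, whereas rho ends with 3/2, 1/2; the prefix
    condition leaves room for one such entry at most, and it must be 3/2
    ([signed_arrangement_cases]).  So t is either t' + 1 followed by - 1/2, with
    t' a positive rearrangement of rank r - 1, or t' + 2 followed by - 1/2, 3/2,
    with t' a positive rearrangement of rank r - 2; conversely both kinds
    satisfy the prefix condition ([append1_signed], [append2_signed]).  These
    two families account for P_(r-1) and P_(r-2). *)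

(** * Cardinality of finite sets *)

Lemma set_card_image (T U : choiceType) (f : T -> U) (A : set T) :
  finite_set A -> {in A &, injective f} -> set_card (f @` A) = set_card A.
Proof.
move=> finA injf; rewrite /set_card fset_set_image // card_in_imfset //=.
by move=> x y; rewrite !in_fset_set //; exact: injf.
Qed.

Lemma set_cardU (T : choiceType) (A B : set T) :
  finite_set A -> finite_set B -> A `&` B = set0 ->
  set_card (A `|` B) = (set_card A + set_card B)%N.
Proof.
move=> finA finB AB0; rewrite /set_card fset_setU // cardfsU -fset_setI //.
by rewrite AB0 fset_set0 cardfs0 subn0.
Qed.

(** * Partial sums and the partition function *)

Lemma epsE r k (j : 'I_r) (u : 'I_1) : eps r k j u = ((j : nat) == k)%:R.
Proof. by rewrite mxE. Qed.

(** Valid also for the last simple root, although it is not a difference of two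
    basis vectors: the subtracted one would lie outside the range of indices. *)
Lemma simple_rootE r (i j : 'I_r) :
  simple_root i j 0 = ((j : nat) == i)%:R - ((j : nat) == i.+1)%:R.
Proof.
rewrite /simple_root; case: ifP => lt_ir; rewrite !mxE //.
suff -> : ((j : nat) == i.+1) = false by rewrite subr0.
by apply/eqP => eq_ji; move: (ltn_ord j); rewrite eq_ji lt_ir.
Qed.

Lemma sum_simple_coord r (c : nat -> rat) (j : 'I_r) :
  \sum_(i < r) c i * (simple_root i j 0) =
    c j - (if (j : nat) is k.+1 then c k else 0).
Proof.
under eq_bigr => i _ do rewrite simple_rootE mulrBr.
rewrite sumrB; congr (_ - _).
  rewrite (bigD1 j) //= eqxx mulr1 big1 ?addr0 // => i.
  by rewrite -val_eqE /= eq_sym => /negbTE ->; rewrite mulr0.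
case: j => -[|k] lt_kr /=.
  by rewrite big1 // => i _; rewrite mulr0.
rewrite (bigD1 (Ordinal (ltnW lt_kr))) //= eqxx mulr1 big1 ?addr0 // => i.
rewrite -val_eqE /= eqSS eq_sym => /negbTE ->; exact: mulr0.
Qed.

Definition partial_sum (r : nat) (v : 'cV[rat]_r) (k : nat) : rat :=
  \sum_(j < r | (j < k)%N) v j 0.

Lemma partial_sumD r (u v : 'cV[rat]_r) k :
  partial_sum (u + v) k = partial_sum u k + partial_sum v k.
Proof. by rewrite -big_split; apply: eq_bigr => j _; rewrite mxE. Qed.

Lemma partial_sumB r (u v : 'cV[rat]_r) k :
  partial_sum (u - v) k = partial_sum u k - partial_sum v k.
Proof. by rewrite -sumrB; apply: eq_bigr => j _; rewrite !mxE. Qed.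

Lemma partial_sum_lincomb r (I : finType) (a : I -> 'cV[rat]_r)
    (m : I -> nat) k :
  partial_sum (\sum_x a x *+ m x) k = \sum_x partial_sum (a x) k *+ m x.
Proof.
rewrite /partial_sum.
under eq_bigr => j _ do rewrite summxE.
rewrite exchange_big /=; apply: eq_bigr => x _.
by rewrite -sumrMnl; apply: eq_bigr => j _; rewrite mulmxnE.
Qed.

Lemma partial_sumS r (v : 'cV[rat]_r) (j : 'I_r) :
  partial_sum v j.+1 = partial_sum v j + v j 0.
Proof.
rewrite /partial_sum (bigD1 j) //= addrC; congr (_ + _).
by apply: eq_bigl => i; rewrite -val_eqE /= ltnS ltn_neqAle andbC.
Qed.

Lemma partial_sum_eps r (i : 'I_r) k : partial_sum (eps r i) k = (i < k)%N%:R.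
Proof.
rewrite /partial_sum big_mkcond (bigD1 i) //= big1 => [|j].
  by rewrite epsE eqxx addr0; case: ifP.
by rewrite epsE val_eqE => /negbTE ->; case: ifP.
Qed.

(** The partial sums of a vector are its coordinates on the basis of simple
    roots; this is what makes them govern the partition function. *)
Lemma simple_root_expansion r (v : 'cV[rat]_r) :
  v = \sum_(i < r) partial_sum v i.+1 *: simple_root i.
Proof.
apply/colP => j; rewrite summxE.
under eq_bigr => i _ do rewrite mxE.
rewrite (sum_simple_coord (fun i => partial_sum v i.+1)) partial_sumS.
suff <- : partial_sum v j = (if (j : nat) is k.+1 then partial_sum v k.+1 else 0).
  by rewrite addrC addKr.
by case: j => -[|k] //= _; rewrite /partial_sum big1.
Qed.

Lemma mem_pos_rootsP r (a : 'cV[rat]_r) :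
  reflect
    [\/ exists2 p : 'I_r * 'I_r, (p.1 < p.2)%N & a = eps r p.1 - eps r p.2,
        exists2 p : 'I_r * 'I_r, (p.1 < p.2)%N & a = eps r p.1 + eps r p.2
      | exists i : 'I_r, a = eps r i]
    (a \in pos_roots r).
Proof.
rewrite /pos_roots in_fset /pos_root_seq !mem_cat.
apply: (iffP or3P) => -[] H.
- by case/mapP: H => p; rewrite mem_filter => /andP[lt_p _] ->;
    constructor 1; exists p.
- by case/mapP: H => p; rewrite mem_filter => /andP[lt_p _] ->;
    constructor 2; exists p.
- by case/mapP: H => i _ ->; constructor 3; exists i.
- case: H => p lt_p ->; constructor 1; apply/mapP; exists p => //.
  by rewrite mem_filter lt_p mem_enum.
- case: H => p lt_p ->; constructor 2; apply/mapP; exists p => //.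
  by rewrite mem_filter lt_p mem_enum.
- by case: H => i ->; constructor 3; apply/mapP; exists i; rewrite ?mem_enum.
Qed.

Lemma simple_root_pos r (i : 'I_r) : simple_root i \in pos_roots r.
Proof.
apply/mem_pos_rootsP; rewrite /simple_root; case: ifP => lt_ir.
  by constructor 1; exists (i, Ordinal lt_ir) => /=.
by constructor 3; exists i.
Qed.

Lemma partial_sum_pos_root r (a : 'cV[rat]_r) k :
  a \in pos_roots r -> partial_sum a k \is a Num.nat.
Proof.
case/mem_pos_rootsP => [[p lt_p ->]|[p _ ->]|[i ->]].
- rewrite partial_sumB !partial_sum_eps -natrB ?natr_nat //.
  by case: (ltnP p.2 k) => // lt_pk; rewrite (ltn_trans lt_p).
- by rewrite partial_sumD !partial_sum_eps -natrD natr_nat.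
- by rewrite partial_sum_eps natr_nat.
Qed.

(** The sum of the coordinates on the simple roots, whence the name. *)
Definition height (r : nat) (v : 'cV[rat]_r) : rat :=
  \sum_(k < r) partial_sum v k.+1.

Lemma height_lincomb r (I : finType) (a : I -> 'cV[rat]_r) (m : I -> nat) :
  height (\sum_x a x *+ m x) = \sum_x height (a x) *+ m x.
Proof.
transitivity (\sum_(k < r) \sum_x partial_sum (a x) k.+1 *+ m x).
  by apply: eq_bigr => k _; rewrite partial_sum_lincomb.
by rewrite exchange_big; apply: eq_bigr => x _; rewrite -sumrMnl.
Qed.

Lemma height_pos_root r (a : 'cV[rat]_r) : a \in pos_roots r -> 1 <= height a.
Proof.
move=> pos_a.
(* The partial sum that ends at the first index of the root is positive. *)
have [i le1] : exists i : 'I_r, 1 <= partial_sum a i.+1.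
  case/mem_pos_rootsP: pos_a => [[p lt_p ->]|[p _ ->]|[i ->]].
  - exists p.1; rewrite partial_sumB !partial_sum_eps ltnSn ltnS leqNgt lt_p.
    by rewrite subr0.
  - exists p.1; rewrite partial_sumD !partial_sum_eps ltnSn lerDl.
    exact: ler0n.
  - by exists i; rewrite partial_sum_eps ltnSn.
rewrite /height (bigD1 i) //= -[1]addr0 lerD // sumr_ge0 // => k _.
by apply: natr_ge0; exact: partial_sum_pos_root.
Qed.

(** Every positive root has height at least 1, so the height of [xi] bounds all
    multiplicities.  Finiteness matters because [fset_set] forgets infinite
    sets: without it the positivity of [kostant] would not follow from the
    existence of one decomposition. *)
Lemma finite_partitions r (xi : 'cV[rat]_r) :
  finite_set [set m : {ffun pos_roots r -> nat} |
                \sum_(a : pos_roots r) fsval a *+ m a = xi].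
Proof.
set N := Num.truncn (height xi).
pose widen (f : {ffun pos_roots r -> 'I_N.+1}) : {ffun pos_roots r -> nat} :=
  [ffun a => f a : nat].
apply: (@sub_finite_set _ _ (range widen)); last first.
  by apply: finite_image; exact: finite_finset.
move=> m /= m_xi.
have m_le a : (m a < N.+1)%N.
  rewrite ltnS /N -(@natrK rat (m a)); apply: le_truncn.
  have -> : height xi = \sum_b height (fsval b) *+ m b.
    by rewrite -m_xi height_lincomb.
  rewrite (bigD1 a) //= -[leLHS]addr0 lerD //.
    by rewrite lerMn2r height_pos_root ?orbT // fsvalP.
  apply: sumr_ge0 => b _; rewrite mulrn_wge0 //.
  by rewrite (le_trans ler01) // height_pos_root // fsvalP.
exists [ffun a => Ordinal (m_le a)] => //.
by apply/ffunP => a; rewrite !ffunE.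
Qed.

(** One way, partial sums of positive roots are 0, 1 or 2; the other way, the
    partial sums are the multiplicities of the simple roots in a decomposition
    that uses no other root. *)
Lemma kostant_gt0 r (xi : 'cV[rat]_r) :
  (0 < kostant xi)%N <-> forall k, partial_sum xi k \is a Num.nat.
Proof.
rewrite /kostant /set_card cardfs_gt0; split.
  case/fset0Pn => m; rewrite in_fset_set; last exact: finite_partitions.
  rewrite inE /= => <- k; rewrite partial_sum_lincomb rpred_sum // => a _.
  by rewrite rpredMn // partial_sum_pos_root // fsvalP.
move=> xi_nat; apply/fset0Pn.
(* A root receives the total coefficient of its preimages, which turns the
   sum over roots into a sum over indices of simple roots. *)
pose sr i := [` simple_root_pos i]%fset : pos_roots r.
pose c (i : 'I_r) := Num.truncn (partial_sum xi i.+1).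
exists [ffun a => \sum_(i | sr i == a) c i]%N.
rewrite in_fset_set; last exact: finite_partitions.
rewrite inE /= [RHS]simple_root_expansion.
under eq_bigr => a _ do rewrite ffunE -sumrMnr.
rewrite (exchange_big_dep predT) //=; apply: eq_bigr => i _.
rewrite (big_pred1 (sr i)) => [|a]; last by rewrite eq_sym.
by rewrite -scaler_nat truncnK.
Qed.

(** * Coordinates of rho and of the highest root *)

(** The sum of the coordinates tells the three families apart: it is 0, 2 and 1
    on them.  Within a family, a root determines its two indices because they
    are ordered. *)
Lemma pos_root_seq_uniq r : uniq (pos_root_seq r).
Proof.
set total := fun v : 'cV[rat]_r => partial_sum v r.
have eqC (p q : 'I_r * 'I_r) (e : rat) :
    eps r p.1 + e *: eps r p.2 = eps r q.1 + e *: eps r q.2 ->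
    forall j : 'I_r, ((j : nat) == p.1)%:R + e * ((j : nat) == p.2)%:R =
                     ((j : nat) == q.1)%:R + e * ((j : nat) == q.2)%:R.
  by move=> /colP eq_pq j; move: (eq_pq j); rewrite !mxE.
have inj (p q : 'I_r * 'I_r) (e : rat) : e = 1 \/ e = -1 ->
    (p.1 < p.2)%N -> (q.1 < q.2)%N ->
    eps r p.1 + e *: eps r p.2 = eps r q.1 + e *: eps r q.2 -> p = q.
  case: p q => [i j] [k l] /= e1 lt_ij lt_kl /(@eqC (i, j) (k, l))/= eq_pq.
  suff /andP[/eqP eq_ik /eqP eq_jl] : ((i : nat) == k) && ((j : nat) == l).
    by congr (_, _); apply: val_inj.
  have crossed : ~~ [&& (i : nat) == l & (j : nat) == k] by lia.
  have once_i : ~~ [&& (i : nat) == k & (i : nat) == l] by lia.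
  have once_k : ~~ [&& (i : nat) == k & (j : nat) == k] by lia.
  have once_l : ~~ [&& (i : nat) == l & (j : nat) == l] by lia.
  have once_j : ~~ [&& (j : nat) == k & (j : nat) == l] by lia.
  have := (eq_pq i, eq_pq j); rewrite !eqxx (ltn_eqF lt_ij) (gtn_eqF lt_ij).
  move: e1 crossed once_i once_j once_k once_l; clear=> e1.
  case: e1 => ->; case: (_ == _ :> nat); case: (_ == _ :> nat);
    case: (_ == _ :> nat); case: (_ == _ :> nat) => //= _ _ _ _ _ []; lra.
rewrite /pos_root_seq !cat_uniq; apply/and5P; split.
- rewrite map_inj_in_uniq 1?filter_uniq ?enum_uniq // => p q.
  rewrite !mem_filter => /andP[lt_p _] /andP[lt_q _] eq_pq.
  by apply: (@inj p q (-1)) => //; [right | rewrite !scaleN1r].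
- apply/hasPn => a; rewrite mem_cat => /orP[] /mapP[p _ ->];
    apply/mapP => -[q _] /(congr1 total);
    rewrite /total ?partial_sumB ?partial_sumD !partial_sum_eps !ltn_ord /=;
    move=> eq_total; lra.
- rewrite map_inj_in_uniq 1?filter_uniq ?enum_uniq // => p q.
  rewrite !mem_filter => /andP[lt_p _] /andP[lt_q _] eq_pq.
  by apply: (@inj p q 1) => //; [left | rewrite !scale1r].
- apply/hasPn => a /mapP[p _ ->]; apply/mapP => -[q _] /(congr1 total).
  by rewrite /total partial_sumD !partial_sum_eps !ltn_ord /= => eq_total; lra.
- rewrite map_inj_uniq ?enum_uniq // => i j /colP/(_ i).
  rewrite !epsE eqxx => /eqP; case: (eqVneq (i : nat) j) => [|_] //.
  by move/val_inj.
Qed.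

Lemma card_ord_gt r (j : 'I_r) : \sum_(q < r | (j < q)%N) 1 = r%:R - j%:R - 1 :> rat.
Proof.
have : \sum_(q < r) 1 = r%:R :> rat by rewrite sumr_const card_ord.
rewrite (bigID (fun q : 'I_r => (j < q)%N)) /= => <-.
have -> : \sum_(q < r | ~~ (j < q)%N) 1 = j.+1%:R :> rat.
  under eq_bigl => q do rewrite -leqNgt -ltnS.
  by rewrite -(big_ord_widen r (fun=> 1)) // sumr_const card_ord.
by rewrite -natr1; lra.
Qed.

(** In coordinate [j] the roots [eps p - eps q] and [eps p + eps q] cancel
    for [q = j] and reinforce each other for [p = j]; so each [q > j]
    contributes 2 and the short root contributes 1. *)
Lemma rhoE r (j : 'I_r) : rho r j 0 = r%:R - j%:R - 2^-1.
Proof.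
rewrite /rho mxE; have -> : \sum_(a <- pos_roots r) a = \sum_(a <- pos_root_seq r) a.
  apply: perm_big; apply: uniq_perm (fset_uniq _) (pos_root_seq_uniq r) _ => a.
  by rewrite in_fset.
have sum_pairs (F : 'I_r * 'I_r -> 'cV[rat]_r) :
    \sum_(a <- [seq F p | p : 'I_r * 'I_r <-
                            [seq p : 'I_r * 'I_r <- enum {: 'I_r * 'I_r} |
                                (p.1 < p.2)%N]]) a =
      \sum_(p : 'I_r * 'I_r | (p.1 < p.2)%N) F p.
  by rewrite big_map big_filter big_enum_cond.
rewrite /pos_root_seq !big_cat /= !sum_pairs big_map big_enum /=.
rewrite !mxE !summxE addrA -big_split /=.
under eq_bigr => p _ do rewrite !mxE addrACA addNr addr0 -mulr2n.
rewrite sumrMnl -(pair_big_dep predT (fun p q : 'I_r => (p < q)%N)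
  (fun p q => ((j : nat) == p)%:R)) /=.
rewrite (bigD1 j) //= [X in (_ + X) *+ 2]big1 => [|p neq_pj]; last first.
  by rewrite big1 // => q _; rewrite val_eqE eq_sym (negbTE neq_pj).
rewrite eqxx card_ord_gt addr0 (bigD1 j) //= epsE eqxx big1 => [|p neq_pj]; last first.
  by rewrite epsE val_eqE eq_sym (negbTE neq_pj).
rewrite /= addr0; lra.
Qed.

Lemma highest_rootE r (j : 'I_r) : highest_root r j 0 = (j < 2)%N%:R.
Proof.
rewrite /highest_root summxE.
pose c i : rat := (if i == 0%N then 1 else 2)%N%:R.
transitivity (\sum_(i < r) c i * simple_root i j 0).
  by apply: eq_bigr => i _; rewrite mulmxnE mulr_natl.
by rewrite sum_simple_coord /c; case: j => -[|[|k]] lt_kr //=; rewrite subrr.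
Qed.

(** The coordinates of the highest root plus rho; the extra 1 in the first two
    places comes from the highest root. *)
Definition dominant_coords (r : nat) : seq rat :=
  mkseq (fun j => r%:R - j%:R - 2^-1 + (j < 2)%N%:R) r.

Definition coords (r : nat) (v : 'cV[rat]_r) : seq rat :=
  mkseq (fun j => if insub j is Some i then v i 0 else 0) r.

Lemma nth_coords r (v : 'cV[rat]_r) (i : 'I_r) : (coords v)`_i = v i 0.
Proof. by rewrite nth_mkseq // valK. Qed.

Lemma coords_highest_rho r :
  coords (highest_root r + rho r) = dominant_coords r.
Proof.
apply: (@eq_from_nth _ 0); rewrite !size_mkseq // => i lt_ir.
rewrite (nth_coords _ (Ordinal lt_ir)) nth_mkseq // mxE rhoE highest_rootE /=.
exact: addrC.
Qed.

(** * The Weyl group as the group of signed permutations *)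

(** Describing a matrix by its action avoids computing with matrix entries:
    composing signed permutations becomes a rewriting step. *)
Definition acts_as (r : nat) (s : 'S_r) (e : 'I_r -> bool) (sigma : 'M[rat]_r) :=
  forall (v : 'cV[rat]_r) i, (sigma *m v) i 0 = (-1) ^+ e i * v (s i) 0.

Lemma acts_as_mul r s t e f (sigma tau : 'M[rat]_r) :
  acts_as s e sigma -> acts_as t f tau ->
  acts_as (s * t)%g (fun i => e i (+) f (s i)) (sigma *m tau).
Proof.
move=> act_s act_t v i.
by rewrite -mulmxA act_s act_t permM signr_addb mulrA.
Qed.

Lemma acts_as_id r : acts_as 1%g (fun=> false) (1%:M : 'M[rat]_r).
Proof. by move=> v i; rewrite mul1mx perm1 expr0 mul1r. Qed.

Lemma eq_acts_as r s e f (sigma : 'M[rat]_r) :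
  e =1 f -> acts_as s e sigma -> acts_as s f sigma.
Proof. by move=> eq_ef act_s v i; rewrite act_s eq_ef. Qed.

Lemma acts_as_unique_mx r s e (sigma tau : 'M[rat]_r) :
  acts_as s e sigma -> acts_as s e tau -> sigma = tau.
Proof.
move=> act_sigma act_tau; apply/matrixP => i j.
have := act_sigma (delta_mx j 0) i; rewrite -act_tau -!colE !mxE; exact.
Qed.

(** A signed permutation is recovered from the image of a vector whose entries
    are positive and distinct. *)
Lemma acts_as_unique_perm r s t e f (sigma : 'M[rat]_r) :
  acts_as s e sigma -> acts_as t f sigma -> s = t /\ e =1 f.
Proof.
move=> act_s act_t.
pose v : 'cV[rat]_r := \col_i (i : nat).+1%:R.
have eq_v i : (-1) ^+ e i * (s i : nat).+1%:R = (-1) ^+ f i * (t i : nat).+1%:R :> rat.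
  by have := act_s v i; rewrite act_t !mxE => ->.
have eq_st : s = t.
  apply/permP => i; have /(congr1 Num.norm) := eq_v i.
  rewrite !normrM !normr_sign !mul1r !normr_nat => /eqP.
  by rewrite eqr_nat eqSS => /eqP/val_inj.
split=> // i; have := eq_v i; rewrite eq_st => /mulIf.
rewrite pnatr_eq0 => /(_ isT)/eqP.
by rewrite (inj_eq (@signr_inj _)) => /eqP.
Qed.

Lemma dot_eps r (i : 'I_r) (v : 'cV[rat]_r) : dot (eps r i) v = v i 0.
Proof.
rewrite /dot (bigD1 i) //= epsE eqxx mul1r big1 ?addr0 // => j.
by rewrite epsE val_eqE => /negbTE ->; rewrite mul0r.
Qed.

Lemma dotBl r (u v w : 'cV[rat]_r) : dot (u - v) w = dot u w - dot v w.
Proof. by rewrite -sumrB; apply: eq_bigr => i _; rewrite !mxE mulrBl. Qed.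

Lemma reflectionE r (a v : 'cV[rat]_r) i :
  (reflection a *m v) i 0 = v i 0 - 2 / dot a a * dot a v * a i 0.
Proof.
rewrite /reflection mulmxBl mul1mx -scalemxAl -mulmxA !mxE big_ord1.
rewrite [a^T *m v]mx11_scalar mxE eqxx !mxE.
have -> : \sum_j a^T 0 j * v j 0 = dot a v.
  by apply: eq_bigr => j _; rewrite mxE.
by rewrite -mulrA [a i 0 * _]mulrC.
Qed.

(** For the last index [insub] fails, and the underlying permutation of the last
    simple reflection is indeed trivial. *)
Definition simple_perm (r : nat) (i : 'I_r) : 'S_r :=
  if insub i.+1 is Some j then tperm i j else 1%g.

Definition simple_sign (r : nat) (i j : 'I_r) : bool :=
  (i.+1 == r) && (j == i).

Lemma simple_refl_acts r (i : 'I_r) :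
  acts_as (simple_perm i) (simple_sign i) (simple_refl i).
Proof.
move=> v k; rewrite /simple_refl reflectionE /simple_perm /simple_sign.
case: insubP => [j lt_ir eq_j | ]; rewrite /simple_root.
  have neq_ij : ((i : nat) == j) = false by rewrite eq_j ltn_eqF.
  rewrite lt_ir (ltn_eqF lt_ir) /= mul1r -eq_j !dotBl !dot_eps !mxE !eqxx.
  rewrite neq_ij eq_sym neq_ij.
  case: tpermP => [->|->|neq_ki neq_kj].
  - by rewrite eqxx neq_ij /=; field.
  - by rewrite eqxx eq_sym neq_ij /=; field.
  - have /negbTE -> : (k : nat) != i by apply/eqP => /val_inj.
    have /negbTE -> : (k : nat) != j by apply/eqP => /val_inj.
    by rewrite subrr mulr0 subr0.
move=> ge_ir; rewrite (negbTE ge_ir) perm1 !dot_eps !mxE eqxx.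
have -> /= : i.+1 == r by rewrite eqn_leq ltn_ord leqNgt.
rewrite val_eqE; case: eqP => [->|_] /=; last by rewrite mulr0 subr0 mul1r.
by field.
Qed.

Definition word_perm (r : nat) (w : seq 'I_r) : 'S_r :=
  (\prod_(i <- w) simple_perm i)%g.

Lemma word_prod_nil r : word_prod [::] = 1%:M :> 'M[rat]_r.
Proof. by rewrite /word_prod big_nil. Qed.

Lemma word_prod_cons r (i : 'I_r) w :
  word_prod (i :: w) = simple_refl i *m word_prod w.
Proof. by rewrite /word_prod big_cons. Qed.

Lemma word_prod_cat r (w w' : seq 'I_r) :
  word_prod (w ++ w') = word_prod w *m word_prod w'.
Proof. by rewrite /word_prod big_cat. Qed.

Lemma word_acts r (w : seq 'I_r) :
  exists2 e, acts_as (word_perm w) e (word_prod w) &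
    all (fun i : 'I_r => i.+1 != r) w -> e =1 (fun=> false).
Proof.
elim: w => [|i w [e act_w e0]].
  exists (fun=> false) => //; rewrite word_prod_nil /word_perm big_nil.
  exact: acts_as_id.
exists (fun j => simple_sign i j (+) e (simple_perm i j)) => /=.
  rewrite word_prod_cons /word_perm big_cons.
  exact: acts_as_mul (simple_refl_acts i) act_w.
by case/andP=> /negbTE neq_ir /e0 e_w j; rewrite e_w /simple_sign neq_ir.
Qed.

(** Forgetting signs is a morphism that kills the last simple reflection. *)
Lemma word_perm_filter r (w : seq 'I_r) :
  word_perm [seq i : 'I_r <- w | i.+1 != r] = word_perm w.
Proof.
rewrite /word_perm big_filter big_mkcond; apply: eq_bigr => i _.
case: eqP => //= eq_ir; rewrite /simple_perm insubN //.
by rewrite eq_ir ltnn.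
Qed.

(** Working with pairs (permutation, signs) rather than with matrices lets the
    generation argument be carried out in the group of permutations. *)
Definition realized (r : nat) (s : 'S_r) (e : 'I_r -> bool) :=
  exists w, acts_as s e (word_prod w).

Lemma realized_mul r (s t : 'S_r) e f :
  realized s e -> realized t f ->
  realized (s * t)%g (fun i => e i (+) f (s i)).
Proof.
move=> [w act_w] [w' act_w']; exists (w ++ w'); rewrite word_prod_cat.
exact: acts_as_mul.
Qed.

Lemma eq_realized r (s : 'S_r) e f : e =1 f -> realized s e -> realized s f.
Proof. by move=> eq_ef [w act_w]; exists w; apply: eq_acts_as act_w. Qed.

Lemma realized_refl r (i : 'I_r) : realized (simple_perm i) (simple_sign i).
Proof.
exists [:: i]; rewrite word_prod_cons word_prod_nil mulmx1.
exact: simple_refl_acts.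
Qed.

Lemma realized1 r : realized (1 : 'S_r)%g (fun=> false).
Proof. by exists [::]; rewrite word_prod_nil; exact: acts_as_id. Qed.

(** By induction on the distance: a transposition is the conjugate of a shorter
    one by an adjacent one. *)
Lemma realized_tperm r (i j : 'I_r) : realized (tperm i j) (fun=> false).
Proof.
wlog le_ij : i j / (i <= j)%N.
  by move=> th; case/orP: (leq_total i j) => /th //; rewrite tpermC.
have [n def_j] : exists n, (j : nat) = (i + n)%N.
  by exists (j - i)%N; rewrite subnKC.
elim: n j def_j {le_ij} => [|n IHn] j def_j.
  have -> : j = i by apply: val_inj; rewrite /= def_j addn0.
  by rewrite tperm1; exact: realized1.
have lt_kr : (i + n < r)%N by rewrite (leq_trans _ (ltn_ord j)) // def_j addnS ltnW.
pose k := Ordinal lt_kr.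
have adj : realized (tperm k j) (fun=> false).
  have := realized_refl k; rewrite /simple_perm insubT /= => [|lt_Skr].
    by rewrite -addnS -def_j ltn_ord.
  have -> : Sub (i + n).+1 lt_Skr = j by apply: val_inj; rewrite /= def_j addnS.
  apply: eq_realized => l; rewrite /simple_sign /=.
  by rewrite -addnS -def_j (ltn_eqF (ltn_ord j)).
case: (posnP n) => [n0 | n_gt0].
  suff <- : k = i by [].
  by apply: val_inj; rewrite /= n0 addn0.
have <- : (tperm i k ^ tperm k j)%g = tperm i j.
  rewrite tpermJ tpermL tpermD // -val_eqE /=.
    by rewrite -[X in _ != X]addn0 eqn_add2l -lt0n.
  by rewrite def_j -[X in _ != X]addn0 eqn_add2l.
rewrite conjgE tpermV.
have := realized_mul adj (realized_mul (IHn k erefl) adj).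
exact: eq_realized.
Qed.

Lemma realized_perm r (s : 'S_r) : realized s (fun=> false).
Proof.
case: (prod_tpermP s) => ts -> _; elim: ts => [|t ts IHts].
  by rewrite big_nil; exact: realized1.
rewrite big_cons; have := realized_mul (realized_tperm t.1 t.2) IHts.
exact: eq_realized.
Qed.

(** The sign change of one coordinate is conjugate to the last simple
    reflection under a transposition. *)
Lemma realized_sign1 r (i : 'I_r) : realized 1%g (fun j => j == i).
Proof.
have r_gt0 : (0 < r)%N by case: (r) i => [[]|].
have lt_lr : (r.-1 < r)%N by rewrite prednK.
pose l := Ordinal lt_lr.
have last_sign : realized 1%g (fun j => j == l).
  have := realized_refl l.
  rewrite /simple_perm insubN /= ?prednK ?ltnn //.
  by apply: eq_realized => j; rewrite /simple_sign /= prednK // eqxx.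
have := realized_mul (realized_mul (realized_tperm i l) last_sign) (realized_tperm i l).
rewrite mulg1 tperm2; apply: eq_realized => j /=; rewrite addbF.
by have := inj_eq (@perm_inj _ (tperm i l)) j i; rewrite tpermL.
Qed.

Lemma realized_all r (s : 'S_r) e : realized s e.
Proof.
suff sign l : uniq l -> realized (1 : 'S_r)%g (fun i => i \in l).
  have := realized_mul (sign _ (enum_uniq [pred i | e i])) (realized_perm s).
  by rewrite mul1g; apply: eq_realized => i; rewrite mem_enum addbF.
elim: l => [_|i l IHl /= /andP[il uniq_l]]; first exact: realized1.
have := realized_mul (realized_sign1 i) (IHl uniq_l).
rewrite mulg1; apply: eq_realized => j; rewrite perm1 inE.
by case: eqP => // ->; rewrite (negbTE il).
Qed.

Lemma weyl_groupP r (sigma : 'M[rat]_r) :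
  weyl_group r sigma <-> exists s e, acts_as s e sigma.
Proof.
split=> [[w _ <-]|[s [e act_sigma]]].
  by have [e act_w _] := word_acts w; exists (word_perm w), e.
have [w act_w] := realized_all s e; exists w => //.
exact: acts_as_unique_mx act_w act_sigma.
Qed.

Lemma signed_perm_mx r (s : 'S_r) (e : 'I_r -> bool) :
  exists sigma, acts_as s e sigma.
Proof. by have [w act_w] := realized_all s e; exists (word_prod w). Qed.

Lemma weyl_group_finite r : finite_set (weyl_group r).
Proof.
pose mx (p : {perm 'I_r} * {ffun 'I_r -> bool}) : 'M[rat]_r :=
  projT1 (cid (signed_perm_mx p.1 p.2)).
apply: (@sub_finite_set _ _ (range mx)); last first.
  by apply: finite_image; exact: finite_finset.
move=> sigma /weyl_groupP[s [e act_sigma]]; exists (s, finfun e) => //.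
rewrite /mx; case: cid => tau /= act_tau; apply: (acts_as_unique_mx act_tau).
by apply: eq_acts_as act_sigma => i; rewrite ffunE.
Qed.

Lemma reduced_expression_exists r (sigma : 'M[rat]_r) :
  weyl_group r sigma -> exists w, reduced_expression sigma w.
Proof.
move=> [w0 _ w0_sigma].
pose P n := `[< exists2 w : seq 'I_r, word_prod w = sigma & size w = n >].
have exP : exists n, P n by exists (size w0); apply/asboolP; exists w0.
case: (ex_minnP exP) => n /asboolP[w w_sigma <-] min_w.
exists w; split=> // w' w'_sigma; apply: min_w; apply/asboolP.
by exists w'.
Qed.

(** If [sigma] changes no sign, then erasing the last simple reflection from a
    word for [sigma] leaves the underlying permutation, hence [sigma],
    unchanged; so a reduced word does not contain it.  Conversely a word
    without it only permutes coordinates, and reduced words exist. *)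
Lemma no_last_factorP r s e (sigma : 'M[rat]_r) : acts_as s e sigma ->
  (forall i : 'I_r, i.+1 = r -> ~ contains_factor i sigma) <->
    e =1 (fun=> false).
Proof.
move=> act_sigma; split=> [no_factor | e0 i eq_ir [w [w_sigma min_w] i_w]].
  have [|w red_w] := @reduced_expression_exists r sigma.
    by apply/weyl_groupP; exists s, e.
  have [f act_w f0] := word_acts w; move: act_w; rewrite (proj1 red_w) => act_w.
  have [_ eq_ef] := acts_as_unique_perm act_sigma act_w.
  move=> i; rewrite eq_ef f0 //; apply/allP => j j_w; apply/eqP => eq_jr.
  by apply: (no_factor j eq_jr); exists w.
pose w' := [seq i : 'I_r <- w | i.+1 != r].
have [f act_w _] := word_acts w; have [f' act_w' f'0] := word_acts w'.
move: act_w; rewrite w_sigma => act_w.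
have [eq_s _] := acts_as_unique_perm act_sigma act_w.
have w'_sigma : word_prod w' = sigma.
  apply: acts_as_unique_mx act_w' _; rewrite word_perm_filter -eq_s.
  by apply: eq_acts_as act_sigma => j; rewrite e0 f'0 // filter_all.
have := min_w _ w'_sigma; apply/negP; rewrite -ltnNge size_filter.
rewrite ltn_neqAle count_size andbT -all_count; apply/allP => /(_ i i_w).
by rewrite eq_ir eqxx.
Qed.

(** * Rearrangements of the coordinates of the highest root plus rho *)

Lemma dominant_coords_half_integer r x :
  x \in dominant_coords r -> exists n : nat, x = n%:R + 2^-1.
Proof.
case/mapP => j; rewrite mem_iota add0n /= => lt_jr ->.
exists (r - j.+1 + (j < 2))%N; rewrite natrD natrB // -[j.+1%:R]natr1; lra.
Qed.

Lemma dominant_coords_ge_half r x : x \in dominant_coords r -> 2^-1 <= x.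
Proof.
by case/dominant_coords_half_integer => n ->; rewrite lerDr ler0n.
Qed.

Lemma dominant_coords_uniq r : uniq (dominant_coords r).
Proof.
apply/mkseq_uniqP => i j; rewrite !inE /= => lt_ir lt_jr eq_ij.
have {eq_ij} : (i + (j < 2))%N%:R = (j + (i < 2))%N%:R :> rat.
  by rewrite !natrD; lra.
move/eqP; rewrite eqr_nat => /eqP; case: ltnP; case: ltnP; lia.
Qed.

(** In rank 2 the coordinates are 5/2 and 3/2.  This is what makes the
    recursion start correctly although the families of rank 0 and 1 are empty:
    a negative entry forces the smaller rank to be at least 2. *)
Lemma half_dominant_coords r : 2^-1 \in dominant_coords r -> (2 < r)%N.
Proof.
case/mapP => j; rewrite mem_iota add0n /= => lt_jr.
have : (j + 1)%N%:R <= r%:R :> rat by rewrite ler_nat addn1.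
rewrite natrD; case: (ltnP j 2) => [_|le2j] /= le_jr eq_half; first lra.
by rewrite (leq_ltn_trans le2j).
Qed.

Definition shift (c : rat) (t : seq rat) : seq rat := [seq x + c | x <- t].

Lemma shift_inj c : injective (shift c).
Proof. by apply: inj_map; exact: addIr. Qed.

Lemma shiftK c : cancel (shift (- c)) (shift c).
Proof. by move=> t; apply: mapK => x; rewrite subrK. Qed.

Lemma shiftNK c : cancel (shift c) (shift (- c)).
Proof. by move=> t; apply: mapK => x; rewrite addrK. Qed.

Lemma size_shift c t : size (shift c t) = size t.
Proof. exact: size_map. Qed.

Lemma sum_shift c t :
  \sum_(x <- shift c t) x = \sum_(x <- t) x + c * (size t)%:R.
Proof.
rewrite big_map big_split /=; congr (_ + _).
by rewrite big_const_seq count_predT iter_addr addr0 mulr_natr.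
Qed.

(** The step from rank [r] to rank [r + 1] adds 1 to every coordinate and
    appends 1/2; the same happens to rho, which is why prefix conditions are
    compatible with it. *)
Lemma dominant_coordsS r : (1 < r)%N ->
  dominant_coords r.+1 = rcons (shift 1 (dominant_coords r)) 2^-1.
Proof.
move=> lt1r; rewrite /dominant_coords mkseqS ltnNge lt1r /=; congr rcons.
  rewrite /shift -map_comp; apply: eq_map => j /=.
  by rewrite -[r.+1%:R]natr1; ring.
by rewrite -[r.+1%:R]natr1; field.
Qed.

Lemma sum_dominant_coords r : (1 < r)%N ->
  \sum_(x <- dominant_coords r) x = r%:R ^+ 2 / 2 + 2.
Proof.
elim: r => // r IHr; rewrite ltnS leq_eqVlt => /orP[/eqP <-|lt1r].
  by rewrite /dominant_coords /= !big_cons big_nil /=; field.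
rewrite dominant_coordsS // big_rcons sum_shift IHr // size_mkseq -[r.+1%:R]natr1 /=.
by field.
Qed.

(** The prefix condition against rho, whose coordinates in rank n are
    n - 1/2, ..., 3/2, 1/2: the last m of them sum to m^2/2, so those facing
    [t1] sum to (n^2 - m^2)/2 with n and m the sizes of [t] and [t2]. *)
Definition dominates_rho (t : seq rat) := forall t1 t2, t = t1 ++ t2 ->
  ((size t)%:R ^+ 2 - (size t2)%:R ^+ 2) / 2 <= \sum_(x <- t1) x.

Lemma dominates_rho_shift t u :
  dominates_rho (shift (size u)%:R t ++ u) -> dominates_rho t.
Proof.
move=> dom t1 t2 def_t.
have := dom (shift (size u)%:R t1) (shift (size u)%:R t2 ++ u).
rewrite def_t /shift map_cat -catA => /(_ erefl).
rewrite sum_shift !size_cat !size_map !natrD; lra.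
Qed.

(** Adding [size u] to every entry raises the prefixes of [t] exactly as much as
    rho is raised, so only the prefixes that reach into [u] need checking. *)
Lemma dominates_rho_extend t u : dominates_rho t ->
  (forall u1 u2, u = u1 ++ u2 ->
    (((size t)%:R + (size u)%:R) ^+ 2 - (size u2)%:R ^+ 2) / 2 <=
       \sum_(x <- t) x + (size u)%:R * (size t)%:R + \sum_(x <- u1) x) ->
  dominates_rho (shift (size u)%:R t ++ u).
Proof.
move=> dom_t dom_u s1 s2 def_s.
rewrite def_s -def_s size_cat size_shift natrD.
have [le_s1t | lt_ts1] := leqP (size s1) (size t).
  have def_s1 : s1 = shift (size u)%:R (take (size s1) t).
    have := congr1 (take (size s1)) def_s.
    by rewrite [RHS]take_size_cat // takel_cat ?size_map // -map_take => /esym.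
  have def_s2 : s2 = shift (size u)%:R (drop (size s1) t) ++ u.
    have := congr1 (drop (size s1)) def_s.
    rewrite [RHS]drop_size_cat // drop_cat size_map -map_drop => <-.
    case: ltngtP le_s1t => // -> _.
    by rewrite drop_size subnn drop0.
  have := dom_t _ _ (esym (cat_take_drop (size s1) t)).
  have := congr1 size (cat_take_drop (size s1) t).
  have -> : \sum_(x <- s1) x = \sum_(x <- shift (size u)%:R (take (size s1) t)) x.
    by rewrite -def_s1.
  rewrite def_s2 sum_shift !size_cat !size_shift.
  move/(congr1 (fun n => n%:R : rat)); rewrite !natrD.
  set a := (size (take _ _))%:R; set b := (size (drop _ _))%:R.
  set c := (size u)%:R; set S := \sum_(_ <- _) _; move=> <- dom_S.
  lra.
have def_s1 : s1 = shift (size u)%:R t ++ take (size s1 - size t) u.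
  have := congr1 (take (size s1)) def_s.
  by rewrite [RHS]take_size_cat // take_cat size_map ltnNge ltnW //= => /esym.
have def_s2 : s2 = drop (size s1 - size t) u.
  have := congr1 (drop (size s1)) def_s.
  by rewrite [RHS]drop_size_cat // drop_cat size_map ltnNge ltnW //= => /esym.
have := dom_u _ _ (esym (cat_take_drop (size s1 - size t) u)).
by rewrite -def_s2 [in X in _ -> X]def_s1 big_cat sum_shift.
Qed.

(** The coordinate vectors attached to the alternation set, see
    [image_alternation_set]. *)
Definition signed_arrangement (r : nat) : set (seq rat) :=
  [set t | perm_eq (map Num.norm t) (dominant_coords r) /\ dominates_rho t].

(** The coordinate vectors attached to the elements without a last factor, see
    [image_P_set]; the bound on [r] reflects that [P_set] is empty below 2. *)
Definition arrangement (r : nat) : set (seq rat) :=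
  [set t | (1 < r)%N /\ perm_eq t (dominant_coords r) /\ dominates_rho t].

Lemma norm_half : `|- 2^-1| = 2^-1 :> rat.
Proof. by rewrite normrN ger0_norm // invr_ge0 ler0n. Qed.

(** The entry - 1/2 comes from the 1/2 that each raise of the rank appends; see
    [dominant_coordsS].  In [append2], 3/2 is the 1/2 of the first raise after
    the second one. *)
Definition append1 (t : seq rat) : seq rat := shift 1 t ++ [:: - 2^-1].

Definition append2 (t : seq rat) : seq rat := shift 2 t ++ [:: - 2^-1; 3 / 2].

Lemma norm_nonneg (t : seq rat) : {in t, forall x, 0 <= x} -> map Num.norm t = t.
Proof.
by move=> t_ge0; rewrite -[RHS]map_id; apply/eq_in_map => x /t_ge0/ger0_norm.
Qed.

Lemma arrangement_ge_half r t x : arrangement r t -> x \in t -> 2^-1 <= x.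
Proof.
by case=> _ [/perm_mem-> _]; exact: dominant_coords_ge_half.
Qed.

Lemma arrangement_signed r : arrangement r `<=` signed_arrangement r.
Proof.
move=> t arr_t; have [_ [perm_t dom_t]] := arr_t; split=> //.
rewrite norm_nonneg // => x /(arrangement_ge_half arr_t); lra.
Qed.

Lemma sum_arrangement r t : arrangement r t ->
  \sum_(x <- t) x = r%:R ^+ 2 / 2 + 2 /\ size t = r.
Proof.
case=> lt1r [perm_t _]; rewrite (perm_big _ perm_t) /= sum_dominant_coords //.
by rewrite (perm_size perm_t) size_mkseq.
Qed.

Lemma append1_signed r t : arrangement r t -> signed_arrangement r.+1 (append1 t).
Proof.
move=> arr_t; have [lt1r [perm_t dom_t]] := arr_t.
have [sum_t size_t] := sum_arrangement arr_t; split.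
  rewrite map_cat norm_nonneg; last first.
    by move=> x /mapP[y /(arrangement_ge_half arr_t) ge_y ->]; lra.
  rewrite /= norm_half dominant_coordsS // -cats1 perm_cat2r.
  exact: perm_map.
apply: (@dominates_rho_extend t [:: - 2^-1]) => // u1 u2 def_u.
rewrite size_t sum_t; case: u1 def_u => [|a [|b u1]] //=.
  by move=> <-; rewrite big_nil /=; lra.
by move=> [<- <-]; rewrite big_seq1 /=; lra.
Qed.

Lemma append2_signed r t : arrangement r t -> signed_arrangement r.+2 (append2 t).
Proof.
move=> arr_t; have [lt1r [perm_t dom_t]] := arr_t.
have [sum_t size_t] := sum_arrangement arr_t; split.
  rewrite map_cat norm_nonneg; last first.
    by move=> x /mapP[y /(arrangement_ge_half arr_t) ge_y ->]; lra.
  rewrite /= norm_half ger0_norm; last by rewrite divr_ge0 ?ler0n.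
  rewrite dominant_coordsS; last exact: ltnW.
  rewrite dominant_coordsS //.
  rewrite /shift map_rcons -map_comp -!cats1 -catA /=.
  have -> : 2^-1 + 1 = 3 / 2 :> rat by field.
  apply: perm_cat; last by rewrite (perm_catC [:: _] [:: _]).
  rewrite [X in perm_eq _ X](_ : _ = shift 2 (dominant_coords r)).
    exact: perm_map.
  by apply: eq_map => x /=; rewrite -addrA.
apply: (@dominates_rho_extend t [:: - 2^-1; 3 / 2]) => // u1 u2 def_u.
rewrite size_t sum_t; case: u1 def_u => [|a [|b [|c u1]]] //=.
- by move=> <-; rewrite big_nil /=; lra.
- by move=> [<- <-]; rewrite big_seq1 /=; lra.
- by move=> [<- <- <-]; rewrite !big_cons big_nil /=; lra.
Qed.

(** The full sum exceeds that of rho by 2 minus twice the absolute values of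
    the negative entries.  This excess is nonnegative, so such an entry is a
    half-integer of absolute value at most 1. *)
Lemma signed_arrangement_neg r t x : (1 < r)%N ->
  signed_arrangement r t -> x \in t -> x < 0 -> x = - 2^-1.
Proof.
move=> lt1r [perm_t dom_t] x_t x_lt0.
have := dom_t t [::] (esym (cats0 t)).
have := sum_dominant_coords lt1r.
rewrite -(perm_big _ perm_t) /= big_map.
have -> : size t = r by rewrite -(size_map Num.norm) (perm_size perm_t) size_mkseq.
move=> sum_norm le_sum.
have : `|x| - x <= \sum_(y <- t) (`|y| - y).
  rewrite (big_rem x) //= lerDl sumr_ge0 // => y _.
  by rewrite subr_ge0 ler_norm.
rewrite sumrB ltr0_norm // => le_x.
have : - x \in dominant_coords r.
  by rewrite -(perm_mem perm_t) -ltr0_norm // map_f.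
case/dominant_coords_half_integer => -[|n] def_x; first lra.
have : 0 <= n%:R :> rat by rewrite ler0n.
move: def_x; rewrite -[n.+1%:R]natr1 => def_x n_ge0; exfalso.
move: le_sum le_x; rewrite /=; lra.
Qed.

Lemma sum_rcons (t : seq rat) z : \sum_(x <- rcons t z) x = \sum_(x <- t) x + z.
Proof. by rewrite -cats1 big_cat big_seq1. Qed.

(** Undoes the shift in a rearrangement of higher rank whose tail [u] is known. *)
Lemma perm_shift_arrangement n c t u : (1 < n)%N -> c = (size u)%:R ->
  perm_eq t (shift c (dominant_coords n)) -> dominates_rho (t ++ u) ->
  exists2 t', arrangement n t' & t ++ u = shift c t' ++ u.
Proof.
move=> lt1n def_c perm_t dom; exists (shift (- c) t); last by rewrite shiftK.
have perm_t' : perm_eq (shift (- c) t) (dominant_coords n).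
  by rewrite -(shiftNK c (dominant_coords n)); exact: perm_map.
split=> //; split=> //; apply: (@dominates_rho_shift _ u).
by rewrite -def_c shiftK.
Qed.

(** Once - 1/2 is present the total excess over rho is 1.  With a last entry [z]
    the prefix condition before it gives [z <= 1 + 1/2].  With last entries [y]
    and [z] after - 1/2 it gives [y + z <= 1 + 3/2 + 1/2], impossible for
    distinct entries that are at least 3/2. *)
Lemma signed_arrangement_cases r t : (1 < r)%N -> signed_arrangement r t ->
  [\/ arrangement r t,
      exists2 t', arrangement (r - 1) t' & t = append1 t' |
      exists2 t', arrangement (r - 2) t' & t = append2 t'].
Proof.
move=> lt1r sgn_t; have [perm_t dom_t] := sgn_t.
have [/allP t_ge0|/allPn[x x_t]] := boolP (all (fun x => 0 <= x) t).
  by constructor 1; split=> //; move: perm_t; rewrite norm_nonneg.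
rewrite -ltNge => /(signed_arrangement_neg lt1r sgn_t x_t) def_x.
(* The absolute values are distinct, so - 1/2 occurs once and all other
   entries are nonnegative. *)
have uniq_t : uniq t.
  by apply: (@map_uniq _ _ Num.norm); rewrite (perm_uniq perm_t) dominant_coords_uniq.
have t_ge0 y : y \in t -> y != - 2^-1 -> 0 <= y.
  move=> y_t; apply: contraR; rewrite -ltNge.
  by move/(signed_arrangement_neg lt1r sgn_t y_t) ->.
have size_t : size t = r by rewrite -(size_map Num.norm) (perm_size perm_t) size_mkseq.
case/splitPr: x_t def_x sgn_t perm_t dom_t uniq_t t_ge0 size_t => t1 t2 ->.
move=> _ perm_t dom_t.
rewrite -cat1s uniq_catCA cat1s /= => /andP[half_notin uniq_t12] t_ge0 size_t.
have t12_ge0 y : y \in t1 ++ t2 -> 0 <= y.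
  move=> y_t; apply: t_ge0; last by apply: contraNneq half_notin => <-.
  by move: y_t; rewrite !mem_cat inE => /orP[] ->; rewrite ?orbT.
have {t_ge0} perm_half : perm_eq (2^-1 :: t1 ++ t2) (dominant_coords r).
  apply: perm_trans perm_t; rewrite map_cat /= norm_half !norm_nonneg.
  - by rewrite -cat1s -(cat1s _ t2) perm_catCA.
  - by move=> y y_t; apply: t12_ge0; rewrite mem_cat y_t orbT.
  - by move=> y y_t; apply: t12_ge0; rewrite mem_cat y_t.
have lt2r : (2 < r)%N.
  by apply: half_dominant_coords; rewrite -(perm_mem perm_half) mem_head.
case: r lt1r lt2r perm_half size_t {perm_t} => // n _; rewrite ltnS => lt1n.
rewrite dominant_coordsS // perm_sym perm_rcons perm_cons perm_sym => perm_12.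
rewrite size_cat /= addnS => -[size_12].
rewrite !subSS subn0.
(* Removing - 1/2 leaves a rearrangement of the coordinates of rank n raised
   by 1, whose sum is thus known. *)
have sum_12 : \sum_(x <- t1) x + \sum_(x <- t2) x = n%:R ^+ 2 / 2 + 2 + n%:R.
  rewrite -big_cat (perm_big _ perm_12) sum_shift sum_dominant_coords //.
  by rewrite size_mkseq mul1r.
have ge_12 y : y \in t1 ++ t2 -> 3 / 2 <= y.
  rewrite (perm_mem perm_12) => /mapP[z /dominant_coords_ge_half ge_z ->]; lra.
have size_tn : (size (t1 ++ - 2^-1 :: t2))%:R = n%:R + 1 :> rat.
  by rewrite size_cat /= addnS size_12 natr1.
move: dom_t perm_12 sum_12 ge_12 uniq_t12 size_tn {half_notin t12_ge0 size_12}.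
case/lastP: t2 => [|t2 z] dom_t perm_12 sum_12 ge_12 uniq_12 size_tn.
  constructor 2; apply: perm_shift_arrangement => //.
  by move: perm_12; rewrite cats0.
have z_ge : 3 / 2 <= z by apply: ge_12; rewrite mem_cat mem_rcons mem_head orbT.
move: sum_12; rewrite sum_rcons => sum_12.
have z_eq : z = 3 / 2.
  have /(_ (t1 ++ - 2^-1 :: t2) [:: z]) := dom_t.
  rewrite size_tn -catA /= cats1 big_cat big_cons => /(_ erefl) /= dom_z.
  lra.
case/lastP: t2 dom_t perm_12 sum_12 ge_12 uniq_12 size_tn => [|t2 y].
  rewrite z_eq /= => dom_t perm_12 sum_12 ge_12 _ size_tn; constructor 3.
  (* As 3/2 comes from 1/2 by a shift, [half_dominant_coords] applies a second
     time and one more rank can be removed. *)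
  have : 3 / 2 \in shift 1 (dominant_coords n).
    by rewrite -(perm_mem perm_12) mem_cat mem_head orbT.
  case/mapP => h h_in eq_h; have {eq_h} def_h : h = 2^-1 by lra.
  move: h_in; rewrite def_h => /half_dominant_coords.
  case: n lt1n perm_12 {sum_12 size_tn ge_12} => // m _.
  move=> perm_12; rewrite ltnS subSS subn0 => lt1m.
  apply: perm_shift_arrangement => //.
  move: perm_12; rewrite dominant_coordsS // /shift map_rcons -map_comp cats1.
  have -> : 2^-1 + 1 = 3 / 2 :> rat by field.
  rewrite perm_rcons perm_sym perm_rcons perm_cons perm_sym.
  by congr perm_eq; apply: eq_map => w /=; rewrite -addrA.
move=> dom_t perm_12 sum_12 ge_12 uniq_12 size_tn; exfalso.
have y_ge : 3 / 2 <= y.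
  by apply: ge_12; rewrite mem_cat !mem_rcons !inE mem_rcons mem_head !orbT.
have y_le : y <= 3 / 2.
  have /(_ (t1 ++ - 2^-1 :: t2) [:: y; z]) := dom_t.
  rewrite size_tn -catA /= -!cats1 -catA big_cat big_cons => /(_ erefl) /= dom_z.
  move: sum_12; rewrite sum_rcons => sum_12.
  lra.
move: uniq_12; rewrite cat_uniq !rcons_uniq mem_rcons inE.
have -> : z = y by lra.
by rewrite eqxx !andbF.
Qed.

(** * From Weyl group elements to rearrangements *)

Lemma partial_sum_coords r (v : 'cV[rat]_r) k : (k <= r)%N ->
  partial_sum v k = \sum_(x <- take k (coords v)) x.
Proof.
elim: k => [|k IHk] lt_kr; first by rewrite take0 big_nil /partial_sum big1.
rewrite (partial_sumS v (Ordinal lt_kr)) /= IHk; last exact: ltnW.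
rewrite (take_nth 0) ?size_mkseq // sum_rcons; congr (_ + _).
by rewrite -(nth_coords v (Ordinal lt_kr)).
Qed.

Lemma partial_sum_rho r k : (k <= r)%N ->
  partial_sum (rho r) k = (r%:R ^+ 2 - (r - k)%N%:R ^+ 2) / 2.
Proof.
elim: k => [|k IHk] lt_kr; first by rewrite subn0 subrr mul0r /partial_sum big1.
rewrite (partial_sumS _ (Ordinal lt_kr)) /= IHk; last exact: ltnW.
rewrite rhoE /= !natrB //; last exact: ltnW.
by rewrite -[k.+1%:R]natr1; field.
Qed.

Lemma dominates_rhoP r (v : 'cV[rat]_r) :
  dominates_rho (coords v) <->
  forall k, (k <= r)%N -> 0 <= partial_sum (v - rho r) k.
Proof.
split=> [dom k le_kr | dom t1 t2 def_t].
  rewrite partial_sumB partial_sum_rho // partial_sum_coords // subr_ge0.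
  have := dom _ _ (esym (cat_take_drop k (coords v))).
  by rewrite size_drop size_mkseq.
have size_t : (size t1 + size t2 = r)%N by rewrite -size_cat -def_t size_mkseq.
have le_1r : (size t1 <= r)%N by rewrite -size_t leq_addr.
have := dom _ le_1r; rewrite partial_sumB partial_sum_rho // partial_sum_coords //.
rewrite subr_ge0 def_t take_size_cat // size_cat.
by rewrite -[in X in (X - _)%N]size_t addKn size_t.
Qed.

Definition shifted_highest (r : nat) : 'cV[rat]_r := highest_root r + rho r.

Lemma nth_coords_orbit r s e (sigma : 'M[rat]_r) (i : 'I_r) :
  acts_as s e sigma ->
  (coords (sigma *m shifted_highest r))`_i =
    (-1) ^+ e i * (dominant_coords r)`_(s i).
Proof.
by move=> act_sigma; rewrite nth_coords act_sigma -coords_highest_rho nth_coords.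
Qed.

Lemma nth_dominant_coords_ge_half r (i : 'I_r) : 2^-1 <= (dominant_coords r)`_i.
Proof. by apply: (@dominant_coords_ge_half r); rewrite mem_nth ?size_mkseq. Qed.

(** Entries of the orbit and of rho are all half an odd integer, so only the
    sign of the partial sums of their difference is a condition. *)
Lemma partial_sum_orbit_int r s e (sigma : 'M[rat]_r) k :
  acts_as s e sigma ->
  partial_sum (sigma *m shifted_highest r - rho r) k \is a Num.int.
Proof.
move=> act_sigma; apply: rpred_sum => i _.
rewrite mxE [X in _ + X]mxE rhoE -(nth_coords (sigma *m _)).
rewrite (nth_coords_orbit i act_sigma).
have [|n ->] := @dominant_coords_half_integer r (dominant_coords r)`_(s i).
  by rewrite mem_nth ?size_mkseq.
have r_i : r%:R = (r - i.+1)%N%:R + i%:R + 1 :> rat.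
  by rewrite natrB // -[i.+1%:R]natr1; ring.
rewrite r_i; case: (e i).
  have -> : (-1) ^+ true * (n%:R + 2^-1) -
     ((r - i.+1)%N%:R + i%:R + 1 - i%:R - 2^-1) = - (n%:R + (r - i.+1)%N%:R + 1) :> rat.
    by rewrite expr1; field.
  by rewrite rpredN !rpredD ?rpred1 // intr_nat.
have -> : (-1) ^+ false * (n%:R + 2^-1) -
   ((r - i.+1)%N%:R + i%:R + 1 - i%:R - 2^-1) = n%:R - (r - i.+1)%N%:R :> rat.
  by rewrite expr0; field.
by rewrite rpredB // intr_nat.
Qed.

Lemma alternation_setP r s e (sigma : 'M[rat]_r) : acts_as s e sigma ->
  alternation_set r sigma <->
  dominates_rho (coords (sigma *m shifted_highest r)).
Proof.
move=> act_sigma; have W_sigma : weyl_group r sigma by apply/weyl_groupP; exists s, e.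
rewrite dominates_rhoP /alternation_set /= -/(shifted_highest r).
split=> [[_ /kostant_gt0 nat_ps] k _ | dom].
  exact: natr_ge0 (nat_ps k).
split=> //; apply/kostant_gt0 => k.
rewrite natrEint (partial_sum_orbit_int _ act_sigma) /=.
have [/dom // | lt_rk] := leqP k r.
suff -> : partial_sum (sigma *m shifted_highest r - rho r) k =
          partial_sum (sigma *m shifted_highest r - rho r) r by exact: dom.
by apply: eq_bigl => i; rewrite ltn_ord (ltn_trans (ltn_ord i) lt_rk).
Qed.

Lemma perm_eq_nthP r (t u : seq rat) : size t = r -> size u = r ->
  perm_eq t u <-> exists s : 'S_r, forall i : 'I_r, t`_i = u`_(s i).
Proof.
move=> size_t /eqP size_u.
have -> : u = Tuple size_u by [].
split=> [/tuple_permP[s ->]|[s eq_tu]].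
  by exists s => i; rewrite -tnth_nth tnth_mktuple (tnth_nth 0).
apply/tuple_permP; exists s; apply: (@eq_from_nth _ 0).
  by rewrite size_tuple.
move=> i; rewrite size_t => lt_ir.
rewrite (eq_tu (Ordinal lt_ir)) -[RHS](tnth_nth 0 _ (Ordinal lt_ir)).
by rewrite tnth_mktuple (tnth_nth 0).
Qed.

Definition orbit_coords (r : nat) (sigma : 'M[rat]_r) : seq rat :=
  coords (sigma *m shifted_highest r).

Lemma norm_orbit_coords r s e (sigma : 'M[rat]_r) : acts_as s e sigma ->
  perm_eq (map Num.norm (orbit_coords sigma)) (dominant_coords r).
Proof.
move=> act_sigma; apply/(@perm_eq_nthP r); rewrite ?size_map ?size_iota //.
exists s => i; rewrite (nth_map 0) ?size_mkseq // (nth_coords_orbit i act_sigma).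
rewrite normrM normr_sign mul1r ger0_norm //.
by apply: le_trans (nth_dominant_coords_ge_half (s i)); rewrite invr_ge0 ler0n.
Qed.

Lemma orbit_coords_inj r : {in weyl_group r &, injective (@orbit_coords r)}.
Proof.
move=> sigma tau; rewrite !inE => /weyl_groupP[s [e act_sigma]].
move=> /weyl_groupP[t [f act_tau]] eq_st.
have eq_i i : (-1) ^+ e i * (dominant_coords r)`_(s i) =
              (-1) ^+ f i * (dominant_coords r)`_(t i).
  rewrite -(nth_coords_orbit i act_sigma) -(nth_coords_orbit i act_tau).
  by rewrite -/(orbit_coords _) eq_st.
have gt0 i : 0 < (dominant_coords r)`_(i : 'I_r).
  by apply: lt_le_trans (nth_dominant_coords_ge_half i); rewrite invr_gt0 ltr0n.
have eq_perm : s = t.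
  apply/permP => i; apply/val_inj/eqP => /=.
  rewrite -(nth_uniq 0 _ _ (dominant_coords_uniq r)) ?size_mkseq //.
  have /(congr1 Num.norm) := eq_i i.
  by rewrite !normrM !normr_sign !mul1r !gtr0_norm // => ->.
apply: (acts_as_unique_mx act_sigma); rewrite eq_perm.
apply: eq_acts_as act_tau => i; have := eq_i i; rewrite eq_perm => /mulIf.
by rewrite gt_eqF // => /(_ isT)/eqP; rewrite (inj_eq (@signr_inj _)) => /eqP.
Qed.

Lemma image_alternation_set r :
  @orbit_coords r @` alternation_set r = signed_arrangement r.
Proof.
apply/seteqP; split=> [_ [sigma alt_sigma <-]|t [perm_t dom_t]].
  have [/weyl_groupP[s [e act_sigma]] _] := alt_sigma; split.
    exact: norm_orbit_coords act_sigma.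
  exact/(alternation_setP act_sigma).
have size_t : size t = r by rewrite -(size_map Num.norm) (perm_size perm_t) size_mkseq.
have [||s eq_s] :=
  proj1 (@perm_eq_nthP r (map Num.norm t) (dominant_coords r) _ _) perm_t.
- by rewrite size_map.
- by rewrite size_mkseq.
have [sigma act_sigma] := signed_perm_mx s (fun i => t`_i < 0).
have orbit_t : orbit_coords sigma = t.
  apply: (@eq_from_nth _ 0); rewrite size_mkseq ?size_t // => i lt_ir.
  rewrite (nth_coords_orbit (Ordinal lt_ir) act_sigma) -eq_s (nth_map 0) ?size_t //=.
  by rewrite mulr_sign_norm.
exists sigma => //; apply/(alternation_setP act_sigma).
by rewrite -/(orbit_coords sigma) orbit_t.
Qed.

(** An element without a last factor changes no sign, so its vector is positive;
    conversely a positive vector forces all signs to be trivial. *)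
Lemma image_P_set r : @orbit_coords r @` P_set r = arrangement r.
Proof.
rewrite /P_set; case: ltnP => [lt_r2 | lt1r].
  rewrite image_set0; apply/seteqP; split=> // t [lt1r _].
  by move: lt_r2; rewrite ltnNge lt1r.
apply/seteqP; split=> [_ [sigma [alt_sigma no_last] <-]|t arr_t].
  have [/weyl_groupP[s [e act_sigma]] _] := alt_sigma.
  have e0 := proj1 (no_last_factorP act_sigma) no_last.
  split=> //; split; last exact/(alternation_setP act_sigma).
  have := norm_orbit_coords act_sigma; rewrite norm_nonneg // => x.
  case/(nthP 0) => i; rewrite size_mkseq => lt_ir <-.
  rewrite (nth_coords_orbit (Ordinal lt_ir) act_sigma) e0 mul1r.
  by apply: le_trans (nth_dominant_coords_ge_half _); rewrite invr_ge0 ler0n.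
have := arrangement_signed arr_t; rewrite -image_alternation_set.
case=> sigma alt_sigma def_t; exists sigma => //; split=> //.
have [/weyl_groupP[s [e act_sigma]] _] := alt_sigma.
apply/(no_last_factorP act_sigma) => i.
have : 2^-1 <= t`_i.
  by apply: (arrangement_ge_half arr_t); rewrite -def_t mem_nth // size_mkseq.
rewrite -def_t (nth_coords_orbit i act_sigma).
case: (e i) => //; have := nth_dominant_coords_ge_half (s i).
rewrite expr1; lra.
Qed.

(** * Counting *)

Lemma finite_alternation_set r : finite_set (alternation_set r).
Proof. by apply: sub_finite_set (@weyl_group_finite r) => sigma []. Qed.

Lemma P_set_sub r : P_set r `<=` alternation_set r.
Proof. by rewrite /P_set; case: ifP => // _ sigma []. Qed.

Lemma finite_arrangement r : finite_set (arrangement r).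
Proof.
rewrite -image_P_set; apply: finite_image.
exact: sub_finite_set (@P_set_sub r) (finite_alternation_set r).
Qed.

Lemma set_card_orbit_coords r (A : set 'M[rat]_r) : A `<=` alternation_set r ->
  set_card (@orbit_coords r @` A) = set_card A.
Proof.
move=> sub_A; apply: set_card_image.
  exact: sub_finite_set sub_A (finite_alternation_set r).
move=> sigma tau; rewrite !inE => /sub_A[W_sigma _] /sub_A[W_tau _].
by apply: orbit_coords_inj; rewrite inE.
Qed.

Lemma append1_inj : injective append1.
Proof.
move=> t u /eqP; rewrite /append1 !cats1 eqseq_rcons andbC => /andP[_ /eqP].
exact: shift_inj.
Qed.

Lemma append2_inj : injective append2.
Proof.
move=> t u /eqP; rewrite /append2 -![_ ++ [:: _; _]]cat_rcons !cats1 !eqseq_rcons.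
by case/andP=> /andP[/eqP/shift_inj].
Qed.

Lemma signed_arrangement_decomposition r : (1 < r)%N ->
  signed_arrangement r = arrangement r `|`
    (append1 @` arrangement (r - 1) `|` append2 @` arrangement (r - 2)).
Proof.
move=> lt1r; apply/seteqP; split=> [t /(signed_arrangement_cases lt1r)|t].
  case=> [arr_t|[t' arr_t' ->]|[t' arr_t' ->]]; first by left.
    by right; left; exists t'.
  by right; right; exists t'.
case=> [|[[t' arr_t' <-]|[t' arr_t' <-]]]; first exact: arrangement_signed.
  by have := append1_signed arr_t'; rewrite -addn1 subnK // ltnW.
by have := append2_signed arr_t'; rewrite -addn2 subnK.
Qed.

Theorem corollary4p12 (r : nat) (hr : (2 <= r)%N) :
  set_card (alternation_set r) =
    (set_card (P_set r) + set_card (P_set (r - 1)) + set_card (P_set (r - 2)))%N.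
Proof.
rewrite -(@set_card_orbit_coords r (alternation_set r)) // image_alternation_set.
have card_P n : set_card (P_set n) = set_card (arrangement n).
  by rewrite -image_P_set set_card_orbit_coords //; exact: P_set_sub.
have neg_half t : t \in arrangement r -> - 2^-1 \notin t.
  rewrite inE => arr_t; apply/negP => /(arrangement_ge_half arr_t); lra.
rewrite !card_P signed_arrangement_decomposition //.
rewrite set_cardU; first rewrite set_cardU.
- rewrite !set_card_image ?addnA //; try exact: finite_arrangement.
  + by move=> t u _ _; exact: append2_inj.
  + by move=> t u _ _; exact: append1_inj.
- by apply: finite_image; exact: finite_arrangement.
- by apply: finite_image; exact: finite_arrangement.
- apply/seteqP; split=> // t [[t1 _ <-] [t2 _ /(congr1 (last 0))]].
  rewrite !last_cat /=; lra.
- exact: finite_arrangement.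
- by rewrite finite_setU; split; apply: finite_image; exact: finite_arrangement.
- apply/seteqP; split=> // t [/mem_set/neg_half/negP half_notin append_t].
  apply: half_notin; case: append_t => -[t' _ <-].
    by rewrite mem_cat inE eqxx orbT.
  by rewrite mem_cat inE eqxx orbT.
Qed.
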